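(* Let $\mathcal{C}$ be a category, let $\mathcal{L}\colon \mathcal{C}^{op}\to\mathbf{CAT}$ be an indexed category (pseudofunctor), let $\mathcal{E}$ be a category, and let $J=(J_1,J_2)\colon\mathcal{E}\to\Sigma_{\mathcal{C}}\mathcal{L}$ be a functor into the Grothendieck construction. Then $J$ admits a fibred limit (a limit in $\Sigma_{\mathcal C}\mathcal L$ that is preserved by the projection $\pi_1\colon\Sigma_{\mathcal{C}}\mathcal{L}\to\mathcal{C}$) if and only if both of the following conditions hold: (1) the functor $J_1\colon\mathcal{E}\to\mathcal{C}$ admits a limit $(L,\lambda)$ in $\mathcal{C}$, with limit cone $\lambda\colon\Delta_L\Rightarrow J_1$; and (2) the induced functor $\mathcal{L}_*(\lambda)(J_2)\colon\mathcal{E}\to\mathcal{L}(L)$ admits a limit that is preserved by every functor $\mathcal{L}(u)\colon\mathcal{L}(L)\to\mathcal{L}(K)$, for every morphism $u\colon K\to L$ in $\mathcal{C}$. In this case, the limit of $J$ is given by $\bigl(L,\ \lim_{E\in\mathcal{E}}\mathcal{L}_*(\lambda)(J_2)(E)\bigr)$.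
   Context: An indexed category is a category $\mathcal{C}$ with a pseudofunctor $\mathcal{L}\colon\mathcal{C}^{op}\to\mathbf{CAT}$: categories $\mathcal{L}(A)$, functors $\mathcal{L}(f)\colon\mathcal{L}(B)\to\mathcal{L}(A)$ for $f\colon A\to B$, and natural isomorphisms $\eta^A\colon\mathrm{id}\to\mathcal{L}(\mathrm{id}_A)$ (unitors) and $\mu^{f,g}\colon\mathcal{L}(f)\circ\mathcal{L}(g)\to\mathcal{L}(g\circ f)$ (compositors) for $A\xrightarrow{f}B\xrightarrow{g}C$, satisfying the usual coherence laws. The Grothendieck construction $\Sigma_{\mathcal{C}}\mathcal{L}$ has objects pairs $(A,X)$ with $A\in\mathcal{C}$, $X\in\mathcal{L}(A)$; morphisms $(A,X)\to(B,Y)$ are pairs $(f,f')$ with $f\colon A\to B$ in $\mathcal{C}$ and $f'\colon X\to\mathcal{L}(f)(Y)$ in $\mathcal{L}(A)$; composition is $(g,g')\circ(f,f')=(g\circ f,\ \mu^{f,g}_Z\circ\mathcal{L}(f)(g')\circ f')$, and identities are $(\mathrm{id}_A,\eta^A_X)$. The projection $\pi_1\colon\Sigma_{\mathcal{C}}\mathcal{L}\to\mathcal{C}$ takes first components. A functor $J\colon\mathcal{E}\to\Sigma_{\mathcal{C}}\mathcal{L}$ is written $J=(J_1,J_2)$, where $J_1=\pi_1\circ J$ and $J(E)=(J_1(E),J_2(E))$, $J(e)=(J_1(e),J_2(e))$ with $J_2(e)\colon J_2(E)\to\mathcal{L}(J_1(e))(J_2(E'))$ for $e\colon E\to E'$.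 Given a cone $\lambda\colon\Delta_L\Rightarrow J_1$, the functor $\mathcal{L}_*(\lambda)(J_2)\colon\mathcal{E}\to\mathcal{L}(L)$ sends $E$ to $\mathcal{L}(\lambda_E)(J_2(E))$ and $e\colon E\to E'$ to the composite $\mathcal{L}(\lambda_E)(J_2(E))\xrightarrow{\mathcal{L}(\lambda_E)(J_2(e))}\mathcal{L}(\lambda_E)\mathcal{L}(J_1(e))(J_2(E'))\xrightarrow{\mu^{\lambda_E,J_1(e)}}\mathcal{L}(J_1(e)\circ\lambda_E)(J_2(E'))=\mathcal{L}(\lambda_{E'})(J_2(E'))$. *)

(* Defs.v *)
(** Categories have Leibniz equality on morphisms.  All categories below (base,
    fibres, diagram shape) live in one pair of universe levels; smaller ones are
    included by cumulativity. *)
From Stdlib Require Import ProofIrrelevance.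

Set Implicit Arguments.
Unset Strict Implicit.
Unset Printing Implicit Defensive.

Declare Scope cat_scope.
Delimit Scope cat_scope with cat.
Open Scope cat_scope.

Record Category := {
  Obj :> Type;
  Hom : Obj -> Obj -> Type;
  id : forall A : Obj, Hom A A;
  comp : forall A B C : Obj, Hom B C -> Hom A B -> Hom A C;
  id_left : forall (A B : Obj) (f : Hom A B), comp (id B) f = f;
  id_right : forall (A B : Obj) (f : Hom A B), comp f (id A) = f;
  comp_assoc : forall (A B C D : Obj) (h : Hom C D) (g : Hom B C) (f : Hom A B),
    comp h (comp g f) = comp (comp h g) f
}.

Arguments Hom {_} A B.
Arguments id {_} A.
Arguments comp {_ A B C} g f.
Arguments id_left {_ A B} f.
Arguments id_right {_ A B} f.
Arguments comp_assoc {_ A B C D} h g f.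

Notation "g ∘ f" := (comp g f) (at level 40, left associativity) : cat_scope.

Definition is_iso (C : Category) (A B : C) (f : Hom A B) : Prop :=
  exists g : Hom B A, g ∘ f = id A /\ f ∘ g = id B.

Record Functor (C D : Category) := {
  fobj :> C -> D;
  fmap : forall A B : C, Hom A B -> Hom (fobj A) (fobj B);
  fmap_id : forall A : C, fmap (id A) = id (fobj A);
  fmap_comp : forall (A B X : C) (g : Hom B X) (f : Hom A B),
    fmap (g ∘ f) = fmap g ∘ fmap f
}.

Arguments fmap {C D} F {A B} f : rename.
Arguments fmap_id {C D} F A : rename.
Arguments fmap_comp {C D} F {A B X} g f : rename.

Lemma functor_comp_id (C D E : Category) (G : Functor D E) (F : Functor C D)
  (A : C) : fmap G (fmap F (id A)) = id (G (F A)).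
Proof. now rewrite !fmap_id. Qed.

Lemma functor_comp_comp (C D E : Category) (G : Functor D E) (F : Functor C D)
  (A B X : C) (g : Hom B X) (f : Hom A B) :
  fmap G (fmap F (g ∘ f)) = fmap G (fmap F g) ∘ fmap G (fmap F f).
Proof. now rewrite !fmap_comp. Qed.

Definition functor_comp (C D E : Category) (G : Functor D E) (F : Functor C D) :
  Functor C E :=
  {| fobj := fun A => G (F A);
     fmap := fun A B f => fmap G (fmap F f);
     fmap_id := functor_comp_id G F;
     fmap_comp := fun A B X g f => functor_comp_comp G F g f |}.

(** The identity [F i X = F j X] induced by [i = j], regarded as a morphism.
    It makes explicit the identifications left implicit when a composite of
    base morphisms is replaced by an equal morphism. *)
Definition eq_hom (I : Type) (D E : Category) (F : I -> Functor D E) (i j : I)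
  (p : i = j) (X : D) : Hom (F i X) (F j X) :=
  match p in _ = k return Hom (F i X) (F k X) with
  | eq_refl => id (F i X)
  end.

(** Pseudofunctors from the opposite of [C], regarded as a locally discrete
    2-category, to categories; contravariance is built into [reindex]. *)
Record IndexedCategory (C : Category) := {
  fib :> C -> Category;
  reindex : forall A B : C, Hom A B -> Functor (fib B) (fib A);
  unitor : forall (A : C) (Y : fib A), Hom Y (reindex (id A) Y);
  unitor_natural : forall (A : C) (X Y : fib A) (y : Hom X Y),
    unitor Y ∘ y = fmap (reindex (id A)) y ∘ unitor X;
  unitor_iso : forall (A : C) (Y : fib A), is_iso (unitor Y);
  compositor : forall (A B D : C) (f : Hom A B) (g : Hom B D) (Y : fib D),
    Hom (reindex f (reindex g Y)) (reindex (g ∘ f) Y);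
  compositor_natural : forall (A B D : C) (f : Hom A B) (g : Hom B D)
    (X Y : fib D) (y : Hom X Y),
    compositor f g Y ∘ fmap (reindex f) (fmap (reindex g) y)
    = fmap (reindex (g ∘ f)) y ∘ compositor f g X;
  compositor_iso : forall (A B D : C) (f : Hom A B) (g : Hom B D) (Y : fib D),
    is_iso (compositor f g Y);
  compositor_id_left : forall (A B : C) (f : Hom A B) (Y : fib B),
    eq_hom (@reindex A B) (id_right f) Y
      ∘ compositor (id A) f Y ∘ unitor (reindex f Y)
    = id (reindex f Y);
  compositor_id_right : forall (A B : C) (f : Hom A B) (Y : fib B),
    eq_hom (@reindex A B) (id_left f) Y
      ∘ compositor f (id B) Y ∘ fmap (reindex f) (unitor Y)
    = id (reindex f Y);
  compositor_assoc : forall (A B D D' : C)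
    (f : Hom A B) (g : Hom B D) (h : Hom D D') (Y : fib D'),
    eq_hom (@reindex A D') (comp_assoc h g f) Y
      ∘ compositor (g ∘ f) h Y ∘ compositor f g (reindex h Y)
    = compositor f (h ∘ g) Y ∘ fmap (reindex f) (compositor g h Y)
}.

Arguments reindex {C} L {A B} f : rename.
Arguments unitor {C} L {A} Y : rename.
Arguments compositor {C} L {A B D} f g Y : rename.

Section Grothendieck.

Variables (C : Category) (L : IndexedCategory C).

Record total_obj := TotalObj { base : C; fibre : L base }.

Record total_hom (P Q : total_obj) := TotalHom {
  base_map : Hom (base P) (base Q);
  fibre_map : Hom (fibre P) (reindex L base_map (fibre Q))
}.

Definition total_id (P : total_obj) : total_hom P P :=
  @TotalHom P P (id (base P)) (unitor L (fibre P)).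

Definition total_comp (P Q R : total_obj) (g : total_hom Q R)
  (f : total_hom P Q) : total_hom P R :=
  @TotalHom P R (base_map g ∘ base_map f)
    (compositor L (base_map f) (base_map g) (fibre R)
       ∘ fmap (reindex L (base_map f)) (fibre_map g) ∘ fibre_map f).

Lemma total_hom_eq (P Q : total_obj) (f g : total_hom P Q)
  (p : base_map f = base_map g) :
  eq_hom (reindex L (B:=_)) p (fibre Q) ∘ fibre_map f = fibre_map g -> f = g.
Proof.
destruct f as [f f'], g as [g g']; simpl in *; destruct p; simpl.
rewrite id_left; intros ->; reflexivity.
Qed.

Lemma total_id_left (P Q : total_obj) (f : total_hom P Q) :
  total_comp (total_id Q) f = f.
Proof.
apply (@total_hom_eq P Q (total_comp (total_id Q) f) f
  (id_left (base_map f))); simpl.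
rewrite !comp_assoc, compositor_id_right; apply id_left.
Qed.

Lemma total_id_right (P Q : total_obj) (f : total_hom P Q) :
  total_comp f (total_id P) = f.
Proof.
apply (@total_hom_eq P Q (total_comp f (total_id P)) f
  (id_right (base_map f))); simpl.
rewrite <- (comp_assoc _ _ (unitor L _)), <- unitor_natural.
rewrite !comp_assoc, compositor_id_left; apply id_left.
Qed.

Lemma compositor_assoc_fibre (A B D D' : C) (f : Hom A B) (g : Hom B D)
  (h : Hom D D') (W : L A) (X : L B) (Y : L D) (Z : L D')
  (f' : Hom W (reindex L f X)) (g' : Hom X (reindex L g Y))
  (h' : Hom Y (reindex L h Z)) :
  eq_hom (reindex L (B:=D')) (comp_assoc h g f) Z
    ∘ (compositor L (g ∘ f) h Z ∘ fmap (reindex L (g ∘ f)) h'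
        ∘ (compositor L f g Y ∘ fmap (reindex L f) g' ∘ f'))
  = compositor L f (h ∘ g) Z
      ∘ fmap (reindex L f)
          (compositor L g h Z ∘ fmap (reindex L g) h' ∘ g') ∘ f'.
Proof.
pose proof (@comp_assoc (L A)) as assoc.
rewrite !fmap_comp, !assoc, <- compositor_assoc.
f_equal; f_equal.
rewrite <- !assoc; f_equal; f_equal.
symmetry; apply compositor_natural.
Qed.

Lemma total_comp_assoc (P Q R S : total_obj) (h : total_hom R S)
  (g : total_hom Q R) (f : total_hom P Q) :
  total_comp h (total_comp g f) = total_comp (total_comp h g) f.
Proof.
exact (@total_hom_eq P S (total_comp h (total_comp g f))
  (total_comp (total_comp h g) f)
  (comp_assoc (base_map h) (base_map g) (base_map f))
  (compositor_assoc_fibre (fibre_map f) (fibre_map g) (fibre_map h))).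
Qed.

Definition total : Category :=
  {| Obj := total_obj;
     Hom := total_hom;
     id := total_id;
     comp := total_comp;
     id_left := total_id_left;
     id_right := total_id_right;
     comp_assoc := total_comp_assoc |}.

Definition total_proj : Functor total C :=
  {| fobj := fun P : total => base P;
     fmap := fun (P Q : total) (f : Hom P Q) => base_map f;
     fmap_id := fun P => eq_refl;
     fmap_comp := fun P Q R g f => eq_refl |}.

End Grothendieck.

(** A cone with apex [A] is a natural transformation from the constant functor
    at [A] to [F]. *)
Record Cone (E C : Category) (F : Functor E C) := {
  apex : C;
  leg : forall e : E, Hom apex (F e);
  cone_comm : forall (e e' : E) (a : Hom e e'), fmap F a ∘ leg e = leg e'
}.

Arguments leg {E C F} c e : rename.
Arguments cone_comm {E C F} c {e e'} a : rename.

Definition is_limit (E C : Category) (F : Functor E C) (c : Cone F) : Prop :=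
  forall d : Cone F,
    exists! u : Hom (apex d) (apex c), forall e : E, leg c e ∘ u = leg d e.

Lemma map_cone_comm (E C D : Category) (G : Functor C D) (F : Functor E C)
  (c : Cone F) (e e' : E) (a : Hom e e') :
  fmap (functor_comp G F) a ∘ fmap G (leg c e) = fmap G (leg c e').
Proof. now simpl; rewrite <- fmap_comp, cone_comm. Qed.

Definition map_cone (E C D : Category) (G : Functor C D) (F : Functor E C)
  (c : Cone F) : Cone (functor_comp G F) :=
  {| apex := G (apex c);
     leg := (fun e => fmap G (leg c e))
       : forall e : E, Hom (G (apex c)) (functor_comp G F e);
     cone_comm := fun e e' a => map_cone_comm G c a |}.

Definition preserved_by (E C D : Category) (G : Functor C D) (F : Functor E C)
  (c : Cone F) : Prop := is_limit (map_cone G c).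

Section FibredLimits.

Variables (C : Category) (L : IndexedCategory C) (E : Category).
Variable J : Functor E (total L).

Definition is_fibred_limit (c : Cone J) : Prop :=
  is_limit c /\ preserved_by (total_proj L) c.

Definition has_fibred_limit : Prop := exists c : Cone J, is_fibred_limit c.

Definition J1 : Functor E C := functor_comp (total_proj L) J.

Definition J2 (e : E) : L (J1 e) := fibre (J e).

Definition J2_map (e e' : E) (a : Hom e e') :
  Hom (J2 e) (reindex L (fmap J1 a) (J2 e')) := fibre_map (fmap J a).

Variable l : Cone J1.

Definition induced_obj (e : E) : L (apex l) := reindex L (leg l e) (J2 e).

Definition induced_map (e e' : E) (a : Hom e e') :
  Hom (induced_obj e) (induced_obj e') :=
  eq_hom (reindex L (B:=_)) (cone_comm l a) (J2 e')
    ∘ compositor L (leg l e) (fmap J1 a) (J2 e')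
    ∘ fmap (reindex L (leg l e)) (J2_map a).

Lemma eq_hom_trans (I : Type) (D D' : Category) (F : I -> Functor D D')
  (i j k : I) (p : i = j) (q : j = k) (X : D) :
  eq_hom F q X ∘ eq_hom F p X = eq_hom F (eq_trans p q) X.
Proof. destruct q; apply id_left. Qed.

Lemma induced_map_eq (e e' : E) (a : Hom e e') (s : Hom (J e) (J e'))
  (es : fmap J a = s) (q : base_map s ∘ leg l e = leg l e') :
  induced_map a
  = eq_hom (reindex L (B:=_)) q (J2 e')
      ∘ compositor L (leg l e) (base_map s) (J2 e')
      ∘ fmap (reindex L (leg l e)) (fibre_map s).
Proof.
destruct es; unfold induced_map, J2_map.
now rewrite (proof_irrelevance _ q (cone_comm l a)).
Qed.

Lemma induced_map_id (e : E) : induced_map (id e) = id (induced_obj e).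
Proof.
rewrite (induced_map_eq (fmap_id J e) (id_left (leg l e))); simpl.
apply compositor_id_right.
Qed.

Lemma induced_map_comp (e e' e'' : E) (b : Hom e' e'') (a : Hom e e') :
  induced_map (b ∘ a) = induced_map b ∘ induced_map a.
Proof.
assert (q : base_map (fmap J b ∘ fmap J a) ∘ leg l e = leg l e'').
{ simpl. rewrite <- comp_assoc.
  etransitivity; [apply f_equal; exact (cone_comm l a) | exact (cone_comm l b)]. }
rewrite (induced_map_eq (fmap_comp J b a) q); simpl.
unfold induced_map, J2_map.
set (Ja := fmap J a) in *; set (Jb := fmap J b) in *.
set (qa := cone_comm l a : base_map Ja ∘ leg l e = leg l e').
set (qb := cone_comm l b : base_map Jb ∘ leg l e' = leg l e'').
change (cone_comm l a) with qa; change (cone_comm l b) with qb.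
change (fmap J1 a) with (base_map Ja); change (fmap J1 b) with (base_map Jb).
clearbody qa qb Ja Jb.
unfold induced_obj, J2 in *; simpl in *.
revert qb q.
destruct qa; intros qb q; simpl.
pose proof (@comp_assoc (L (apex l))) as assoc.
rewrite id_left, !fmap_comp, !assoc.
rewrite <- (assoc _ _ _ _ _ (compositor L (leg l e) (_ ∘ _) _) _).
rewrite <- compositor_assoc, !assoc, eq_hom_trans.
rewrite (proof_irrelevance _ (eq_trans _ q) qb).
f_equal; rewrite <- !assoc; f_equal; f_equal.
apply compositor_natural.
Qed.

(** The functor written [L_*(l)(J_2)]: reindexing of [J2] along the cone [l]. *)
Definition induced_functor : Functor E (L (apex l)) :=
  {| fobj := induced_obj;
     fmap := induced_map;
     fmap_id := induced_map_id;
     fmap_comp := fun e e' e'' b a => induced_map_comp b a |}.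

Variable k : Cone induced_functor.

Definition total_cone_leg (e : E) :
  @Hom (total L) (TotalObj (apex k)) (J e) :=
  @TotalHom C L (TotalObj (apex k)) (J e) (leg l e) (leg k e).

Lemma total_cone_comm (e e' : E) (a : Hom e e') :
  fmap J a ∘ total_cone_leg e = total_cone_leg e'.
Proof.
apply (@total_hom_eq C L _ _ (fmap J a ∘ total_cone_leg e) (total_cone_leg e')
  (cone_comm l a)); simpl.
rewrite <- (cone_comm k a), !comp_assoc; reflexivity.
Qed.

(** The cone over [J] with apex [(apex l, apex k)] and legs [(leg l e, leg k e)]. *)
Definition total_cone : Cone J :=
  {| apex := TotalObj (apex k) : total L;
     leg := total_cone_leg;
     cone_comm := total_cone_comm |}.

End FibredLimits.

(* Main.v *)
Require Import Defs.
From Stdlib Require Import ProofIrrelevance IndefiniteDescription.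

(** A morphism [(u, t)] of the Grothendieck construction followed by the
    cartesian morphism [(f, id)] is [(f ∘ u, mu ∘ t)], and the compositor [mu] is
    invertible.  Hence morphisms lying over [f ∘ u] into [Q] are the same as
    morphisms lying over [u] into the reindexed object [f^* Q]
    ([cartesian_exists], [cartesian_inj]).

    Fix a cone [l] over [J1] and a cone [k] over the induced functor.  Applying
    this to every leg of [l], the cones over [J] with apex [(K, W)] and base legs
    [leg l e ∘ u] are the cones with apex [W] over the [u]-reindexed induced
    functor; and a mediating morphism to [reindex L u k] in the fibre over [K] is
    a mediating morphism to [total_cone k] that lies over [u].  So [reindex L u]
    preserves [k] exactly when [total_cone k] is universal among the cones lying
    over [u] ([preserved_iff_universal_over]).

    If [l] is a limit, then every cone over [J] lies over exactly one [u].
    Therefore [total_cone k] is a limit iff all the functors [reindex L u]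
    preserve [k] ([total_cone_limit_iff]).  The case [u = id] says that [k] is
    itself a limit, since the unitor identifies [reindex L (id _)] with the
    identity functor.  As every cone over [J] is of the form [total_cone k], this
    gives the equivalence.

    For the formula for the limit, let [c] be a fibred limit of [J], and let [l]
    and [k] be any limits.  Pulling [c] back along the comparison of [l] with the
    base of [c] gives a cone lying over the identity of [apex l].  The universal
    property of [k] turns it into a morphism of cones from [c] to [total_cone k],
    which is inverse to the comparison in the other direction
    ([limit_total_cone]). *)

Set Implicit Arguments.
Unset Strict Implicit.
Unset Printing Implicit Defensive.

(** * Limits in a category *)

Lemma limit_joint_mono (E C : Category) (F : Functor E C) (c : Cone F)
  (hc : is_limit c) (A : C) (f g : Hom A (apex c)) :
  (forall e, leg c e ∘ f = leg c e ∘ g) -> f = g.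
Proof.
intros h.
assert (comm : forall (e e' : E) (a : Hom e e'),
  fmap F a ∘ (leg c e ∘ g) = leg c e' ∘ g).
{ intros e e' a; now rewrite comp_assoc, cone_comm. }
destruct (hc {| apex := A; leg := fun e => leg c e ∘ g; cone_comm := comm |})
  as [w [_ uniq]]; simpl in uniq.
rewrite <- (uniq f h); apply uniq; reflexivity.
Qed.

Lemma limit_of_inverse (E C : Category) (F : Functor E C) (c c' : Cone F)
  (hc : is_limit c) (v : Hom (apex c) (apex c')) (w : Hom (apex c') (apex c)) :
  (forall e, leg c' e ∘ v = leg c e) ->
  (forall e, leg c e ∘ w = leg c' e) ->
  v ∘ w = id (apex c') ->
  is_limit c'.
Proof.
intros hv hw vw d.
destruct (hc d) as [x [hx _]].
exists (v ∘ x); split.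
- intros e; now rewrite comp_assoc, hv.
- intros y hy.
  assert (wy : w ∘ y = x).
  { apply (limit_joint_mono hc); intros e.
    now rewrite hx, comp_assoc, hw, hy. }
  now rewrite <- wy, comp_assoc, vw, id_left.
Qed.

Lemma iso_mono (C : Category) (A B : C) (f : Hom A B) (hf : is_iso f)
  (X : C) (x y : Hom X A) : f ∘ x = f ∘ y -> x = y.
Proof.
destruct hf as [g [gf _]]; intros h.
now rewrite <- (id_left x), <- (id_left y), <- gf, <- !comp_assoc, h.
Qed.

(** The legs of [map_cone G c] are those of [c] up to the isomorphism [n], so
    the two cones have the same universal property. *)
Lemma preserved_by_iso_to_id (E C : Category) (F : Functor E C) (c : Cone F)
  (G : Functor C C) (n : forall X : C, Hom X (G X))
  (n_nat : forall (X Y : C) (f : Hom X Y), n Y ∘ f = fmap G f ∘ n X)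
  (n_iso : forall X : C, is_iso (n X)) :
  is_limit c <-> preserved_by G c.
Proof.
split; intros hc d.
- set (nv := fun X : C =>
    constructive_indefinite_description _ (n_iso X)).
  assert (nvn : forall X, n X ∘ proj1_sig (nv X) = id (G X))
    by (intros X; apply (proj2_sig (nv X))).
  assert (comm : forall (e e' : E) (a : Hom e e'),
    fmap F a ∘ (proj1_sig (nv (F e)) ∘ leg d e)
    = proj1_sig (nv (F e')) ∘ leg d e').
  { intros e e' a; apply (iso_mono (n_iso (F e'))).
    rewrite !comp_assoc, nvn, n_nat, <- (comp_assoc _ (n (F e)) _), nvn.
    rewrite id_left, id_right; exact (cone_comm d a). }
  destruct (hc {| apex := apex d;
                  leg := fun e => proj1_sig (nv (F e)) ∘ leg d e;
                  cone_comm := comm |}) as [x [hx _]]; simpl in x, hx.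
  exists (n (apex c) ∘ x); split; simpl.
  + intros e.
    rewrite comp_assoc, <- n_nat, <- comp_assoc, hx, comp_assoc, nvn.
    apply id_left.
  + intros y hy.
    assert (xy : x = proj1_sig (nv (apex c)) ∘ y).
    { apply (limit_joint_mono hc); intros e.
      rewrite hx; apply (iso_mono (n_iso (F e))).
      rewrite !comp_assoc, nvn, n_nat, <- (comp_assoc _ (n _) _), nvn.
      rewrite id_left, id_right; symmetry; exact (hy e). }
    now rewrite xy, comp_assoc, nvn, id_left.
- assert (comm : forall (e e' : E) (a : Hom e e'),
    fmap (functor_comp G F) a ∘ (n (F e) ∘ leg d e) = n (F e') ∘ leg d e').
  { intros e e' a; simpl.
    now rewrite comp_assoc, <- n_nat, <- comp_assoc, cone_comm. }
  destruct (hc {| apex := apex d;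
                  leg := (fun e => n (F e) ∘ leg d e)
                    : forall e, Hom (apex d) (functor_comp G F e);
                  cone_comm := comm |}) as [x [hx uniq]]; simpl in x, hx, uniq.
  destruct (n_iso (apex c)) as [m [mn nm]].
  exists (m ∘ x); split.
  + intros e; apply (iso_mono (n_iso (F e))).
    rewrite comp_assoc, n_nat, <- comp_assoc, (comp_assoc (n _)), nm, id_left.
    apply hx.
  + intros y hy.
    rewrite (uniq (n _ ∘ y)).
    * now rewrite comp_assoc, mn, id_left.
    * intros e; now rewrite comp_assoc, <- n_nat, <- comp_assoc, hy.
Qed.

(** * Cartesian and vertical morphisms of the Grothendieck construction *)

Section CartesianMorphisms.

Variables (C : Category) (L : IndexedCategory C).

(** The converse of [total_hom_eq], for any proof of equality of the bases. *)
Lemma fibre_map_eq (P Q : total_obj L) (f g : total_hom P Q) (h : f = g)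
  (p : base_map f = base_map g) :
  eq_hom (reindex L (B:=_)) p (fibre Q) ∘ fibre_map f = fibre_map g.
Proof.
destruct h; rewrite (proof_irrelevance _ p eq_refl); apply id_left.
Qed.

Definition hom_over (A : C) (X : L A) (P : total L) (u : Hom (base P) A)
  (s : Hom (fibre P) (reindex L u X)) : @Hom (total L) P (TotalObj X) :=
  @TotalHom C L P (TotalObj X) u s.

Definition cartesian_lift (A : C) (Q : total L) (f : Hom A (base Q)) :
  @Hom (total L) (TotalObj (reindex L f (fibre Q))) Q :=
  @TotalHom C L (TotalObj (reindex L f (fibre Q))) Q f (id _).

Definition vertical (A : C) (X Y : L A) (x : Hom X Y) :
  @Hom (total L) (TotalObj X) (TotalObj Y) :=
  @TotalHom C L (TotalObj X) (TotalObj Y) (id A) (unitor L Y ∘ x).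

Lemma vertical_comp (A : C) (X Y : L A) (x : Hom X Y) (P : total L)
  (u : Hom (base P) A) (s : Hom (fibre P) (reindex L u X)) :
  vertical x ∘ hom_over s
  = hom_over (fmap (reindex L u) x ∘ s).
Proof.
apply (@total_hom_eq C L P (TotalObj Y) (total_comp (vertical x) (hom_over s))
  (hom_over (fmap (reindex L u) x ∘ s)) (id_left u)).
simpl.
rewrite fmap_comp, !comp_assoc, compositor_id_right, id_left; reflexivity.
Qed.

Lemma cartesian_vertical (A : C) (X : L A) (Q : total L) (f : Hom A (base Q))
  (x : Hom X (reindex L f (fibre Q))) :
  cartesian_lift f ∘ vertical x = @TotalHom C L (TotalObj X) Q f x.
Proof.
apply (@total_hom_eq C L (TotalObj X) Q
  (total_comp (cartesian_lift f) (vertical x))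
  (@TotalHom C L (TotalObj X) Q f x) (id_right f)).
simpl.
rewrite fmap_id, (@id_right (L A)), !comp_assoc, compositor_id_left.
rewrite (@id_left (L A)).
reflexivity.
Qed.

Lemma cartesian_comp (A : C) (Q : total L) (f : Hom A (base Q)) (P : total L)
  (u : Hom (base P) A) (s : Hom (fibre P) (reindex L u (reindex L f (fibre Q)))) :
  cartesian_lift f ∘ hom_over s
  = @TotalHom C L P Q (f ∘ u) (compositor L u f (fibre Q) ∘ s).
Proof.
simpl; unfold total_comp; simpl; now rewrite fmap_id, id_right.
Qed.

Lemma cartesian_inj (A : C) (Q : total L) (f : Hom A (base Q)) (P : total L)
  (u : Hom (base P) A)
  (s s' : Hom (fibre P) (reindex L u (reindex L f (fibre Q)))) :
  cartesian_lift f ∘ hom_over s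
  = cartesian_lift f ∘ hom_over s'
  -> s = s'.
Proof.
rewrite !cartesian_comp; intros h.
apply (iso_mono (compositor_iso u f (fibre Q))).
exact (eq_trans (eq_sym (id_left _)) (fibre_map_eq h eq_refl)).
Qed.

Lemma cartesian_exists (A : C) (Q : total L) (f : Hom A (base Q)) (P : total L)
  (u : Hom (base P) A) (h : @Hom (total L) P Q) (hu : base_map h = f ∘ u) :
  exists s : Hom (fibre P) (reindex L u (reindex L f (fibre Q))),
    cartesian_lift f ∘ hom_over s
    = h.
Proof.
destruct h as [b h]; simpl in hu; revert h; rewrite hu; intros h.
destruct (compositor_iso u f (fibre Q)) as [m [_ nm]].
exists (m ∘ h); now rewrite cartesian_comp, comp_assoc, nm, id_left.
Qed.

End CartesianMorphisms.

(** * Cones over a functor into the Grothendieck construction *)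

Section TotalCones.

Variables (C : Category) (L : IndexedCategory C) (E : Category).
Variable J : Functor E (total L).

Section OverCone.

Variables (l : Cone (J1 J)) (k : Cone (induced_functor l)).

(** The universal property of [total_cone k], tested only on the families of
    legs [m] and the mediating morphisms [g] that lie over [u]. *)
Definition universal_over (P : total L) (u : Hom (base P) (apex l)) : Prop :=
  forall m : (forall e, Hom P (J e)),
    (forall (e e' : E) (a : Hom e e'), fmap J a ∘ m e = m e') ->
    (forall e, base_map (m e) = leg l e ∘ u) ->
    exists! g : Hom P (apex (total_cone k)),
      base_map g = u /\ forall e, leg (total_cone k) e ∘ g = m e.

Lemma fmap_cartesian (e e' : E) (a : Hom e e') :
  fmap J a ∘ cartesian_lift (L:=L) (Q:=J e) (leg l e)
  = cartesian_lift (L:=L) (Q:=J e') (leg l e') ∘ vertical (induced_map l a).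
Proof.
etransitivity;
  [| symmetry; exact (cartesian_vertical (Q:=J e') (f:=leg l e')
       (induced_map l a))].
apply (@total_hom_eq C L (TotalObj (induced_obj l e)) (J e')
  (total_comp (fmap J a) (cartesian_lift (L:=L) (Q:=J e) (leg l e)))
  (@TotalHom C L (TotalObj (induced_obj l e)) (J e') (leg l e')
     (induced_map l a)) (cone_comm l a)).
simpl; rewrite id_right, comp_assoc; reflexivity.
Qed.

Lemma fmap_cartesian_comp (e e' : E) (a : Hom e e') (P : total L)
  (u : Hom (base P) (apex l))
  (s : Hom (fibre P) (reindex L u (induced_obj l e))) :
  fmap J a ∘ (cartesian_lift (L:=L) (Q:=J e) (leg l e)
    ∘ hom_over s)
  = cartesian_lift (L:=L) (Q:=J e') (leg l e')
    ∘ hom_over (fmap (reindex L u) (induced_map l a) ∘ s).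
Proof.
rewrite comp_assoc, fmap_cartesian, <- comp_assoc.
apply f_equal; exact (vertical_comp (induced_map l a) s).
Qed.

Lemma total_cone_leg_comp (e : E) (P : total L) (u : Hom (base P) (apex l))
  (t : Hom (fibre P) (reindex L u (apex k))) :
  leg (total_cone k) e
    ∘ hom_over t
  = cartesian_lift (L:=L) (Q:=J e) (leg l e)
    ∘ hom_over (fmap (reindex L u) (leg k e) ∘ t).
Proof.
change (leg (total_cone k) e) with (total_cone_leg k e); unfold total_cone_leg.
rewrite <- (cartesian_vertical (Q:=J e) (leg k e)), <- comp_assoc.
apply f_equal; exact (vertical_comp (leg k e) t).
Qed.

(** Cancelling the cartesian lift of [leg l e] translates cones over [J] that
    lie over [u], and mediating morphisms between them, into cones and mediating
    morphisms for the [u]-reindexed induced functor. *)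
Lemma preserved_iff_universal_over (K : C) (u : Hom K (apex l)) :
  preserved_by (reindex L u) k
  <-> forall W : L K, universal_over (P:=TotalObj W) u.
Proof.
split.
- intros hk W m m_nat m_base.
  set (choice := fun e => constructive_indefinite_description _
    (cartesian_exists (L:=L) (Q:=J e) (P:=TotalObj W) (m_base e))).
  set (s := fun e => proj1_sig (choice e)).
  assert (hs : forall e, cartesian_lift (leg l e)
    ∘ hom_over (P:=TotalObj W) (s e) = m e)
    by (intros e; exact (proj2_sig (choice e))).
  clearbody s.
  assert (comm : forall (e e' : E) (a : Hom e e'),
    fmap (reindex L u) (induced_map l a) ∘ s e = s e').
  { intros e e' a.
    apply (cartesian_inj (Q:=J e') (f:=leg l e') (P:=TotalObj W)).
    rewrite (hs e'), <- (m_nat e e' a), <- (hs e).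
    symmetry; exact (fmap_cartesian_comp (P:=TotalObj W) a (s e)). }
  destruct (hk {| apex := W;
                  leg := s
                    : forall e, Hom W
                        (functor_comp (reindex L u) (induced_functor l) e);
                  cone_comm := comm |}) as [t [ht uniq]]; simpl in t, ht, uniq.
  exists (hom_over (P:=TotalObj W) t); split; [split|].
  + reflexivity.
  + intros e.
    rewrite (total_cone_leg_comp e (P:=TotalObj W)), <- (hs e).
    apply f_equal; simpl; apply f_equal, ht.
  + intros [u' t'] [hu ht']; change (u' = u) in hu; subst u'.
    apply f_equal, uniq; intros e.
    apply (cartesian_inj (Q:=J e) (f:=leg l e) (P:=TotalObj W)).
    rewrite (hs e), <- ht'.
    symmetry; exact (total_cone_leg_comp e (P:=TotalObj W) t').
- intros h d.
  set (m := fun e => cartesian_lift (L:=L) (Q:=J e) (leg l e)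
    ∘ hom_over (P:=TotalObj (apex d)) (leg d e)).
  destruct (h (apex d) m) as [g [[hu hg] uniq]].
  + intros e e' a; unfold m.
    etransitivity;
      [exact (fmap_cartesian_comp (P:=TotalObj (apex d)) a (leg d e)) |].
    apply f_equal; simpl; apply f_equal; exact (cone_comm d a).
  + reflexivity.
  + destruct g as [u' t]; change (u' = u) in hu; subst u'.
    exists t; split.
    * intros e; apply (cartesian_inj (Q:=J e) (f:=leg l e)
        (P:=TotalObj (apex d))).
      etransitivity; [| exact (hg e)].
      symmetry; exact (total_cone_leg_comp e (P:=TotalObj (apex d)) t).
    * intros t' ht'.
      assert (heq : hom_over (P:=TotalObj (apex d)) (X:=apex k) t
        = hom_over (P:=TotalObj (apex d)) (X:=apex k) t').
      { apply uniq; split; [reflexivity|].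
        intros e; etransitivity;
          [exact (total_cone_leg_comp e (P:=TotalObj (apex d)) t') |].
        unfold m; apply f_equal; simpl; apply f_equal, ht'. }
      exact (eq_trans (eq_sym (id_left t)) (fibre_map_eq heq eq_refl)).
Qed.

Lemma base_leg (P : total L) (g : Hom P (apex (total_cone k)))
  (m : forall e, Hom P (J e)) (hg : forall e, leg (total_cone k) e ∘ g = m e)
  (e : E) : leg l e ∘ base_map g = base_map (m e).
Proof. rewrite <- hg; reflexivity. Qed.

Lemma total_cone_limit_iff (hl : is_limit l) :
  is_limit (total_cone k)
  <-> forall (K : C) (u : Hom K (apex l)), preserved_by (reindex L u) k.
Proof.
split.
- intros h K u; apply preserved_iff_universal_over; intros W m m_nat m_base.
  destruct (h {| apex := TotalObj W : total L; leg := m; cone_comm := m_nat |})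
    as [g [hg uniq]]; simpl in g, hg, uniq.
  exists g; split; [split|].
  + apply (limit_joint_mono hl); intros e.
    rewrite <- m_base; exact (base_leg hg e).
  + exact hg.
  + intros g' [_ hg']; apply uniq, hg'.
- intros h [[K W] m m_nat].
  destruct (hl (map_cone (total_proj L)
    {| apex := TotalObj W : total L; leg := m; cone_comm := m_nat |}))
    as [u [hu uniq_u]]; simpl in u, hu, uniq_u.
  destruct (proj1 (preserved_iff_universal_over u) (h K u) W m m_nat)
    as [g [[_ hg] uniq]].
  + intros e; symmetry; apply hu.
  + exists g; split; [exact hg|].
    intros g' hg'; apply uniq; split; [|exact hg'].
    symmetry; apply uniq_u; exact (base_leg hg').
Qed.

Lemma preserved_by_reindex_id :
  is_limit k <-> preserved_by (reindex L (id (apex l))) k.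
Proof.
apply (@preserved_by_iso_to_id _ _ _ k _ (fun X => unitor L X)).
- intros X Y f; apply unitor_natural.
- apply unitor_iso.
Qed.

Lemma limit_total_cone (c : Cone J) (hc : is_fibred_limit c)
  (hl : is_limit l) (hk : is_limit k) : is_limit (total_cone k).
Proof.
destruct hc as [hc hbase].
assert (huniv := proj1 (preserved_iff_universal_over _)
  (proj1 preserved_by_reindex_id hk)).
destruct (hc (total_cone k)) as [w [hw _]].
destruct (hl (map_cone (total_proj L) c)) as [j [hj _]]; simpl in j, hj.
assert (wj : base_map w ∘ j = id (base (apex c))).
{ apply (limit_joint_mono hbase); intros e.
  rewrite comp_assoc, id_right.
  etransitivity; [| exact (hj e)].
  apply (f_equal (fun f => f ∘ j)).
  exact (f_equal (fmap (total_proj L)) (hw e)). }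
(* Pulling [c] back along the base of [w] makes its base legs equal to those of
   [l], which brings it into the scope of the universal property of [k]. *)
set (chi := cartesian_lift (L:=L) (Q:=apex c) (base_map w)).
destruct (huniv _ (fun e => leg c e ∘ chi)) as [v [[_ hv] _]].
{ intros e e' a; now rewrite comp_assoc, cone_comm. }
{ intros e; rewrite id_right.
  exact (f_equal (fmap (total_proj L)) (hw e)). }
(* The identity of [apex c] lies over [base_map w ∘ j], hence factors through
   [chi]: this section of [chi] undoes the pullback. *)
destruct (cartesian_exists (Q:=apex c) (P:=apex c) (h:=id (apex c))
  (eq_sym wj)) as [s hs].
set (sec := hom_over s).
fold chi in hs; change (chi ∘ sec = id (apex c)) in hs.
assert (hvs : forall e, leg (total_cone k) e ∘ (v ∘ sec) = leg c e).
{ intros e; rewrite comp_assoc, hv, <- comp_assoc.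
  etransitivity; [exact (f_equal (comp (leg c e)) hs) | apply id_right]. }
apply (limit_of_inverse hc hvs hw).
(* Both sides lie over the identity and have the same composites with the legs. *)
destruct (huniv _ (leg (total_cone k))) as [g [_ uniq]].
{ intros e e' a; exact (cone_comm (total_cone k) a). }
{ intros e; rewrite id_right; reflexivity. }
assert (hlegs : forall e,
  leg (total_cone k) e ∘ (v ∘ sec ∘ w) = leg (total_cone k) e).
{ intros e; now rewrite comp_assoc, hvs, hw. }
transitivity g; [symmetry|]; apply uniq; split.
- apply (limit_joint_mono hl); intros e.
  rewrite id_right; exact (base_leg hlegs e).
- exact hlegs.
- reflexivity.
- intros e; apply id_right.
Qed.

End OverCone.

Lemma fibre_leg_comm (c : Cone J) (e e' : E) (a : Hom e e') :
  induced_map (map_cone (total_proj L) c) a ∘ fibre_map (leg c e)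
  = fibre_map (leg c e').
Proof.
unfold induced_map.
rewrite <- (fibre_map_eq (cone_comm c a)
  (cone_comm (map_cone (total_proj L) c) a)).
simpl; rewrite !comp_assoc; reflexivity.
Qed.

Definition fibre_cone (c : Cone J) :
  Cone (induced_functor (map_cone (total_proj L) c : Cone (J1 J))) :=
  {| apex := fibre (apex c);
     leg := (fun e => fibre_map (leg c e))
       : forall e, Hom (fibre (apex c))
           (induced_functor (map_cone (total_proj L) c : Cone (J1 J)) e);
     cone_comm := fun e e' a => fibre_leg_comm c a |}.

(** [total_cone (fibre_cone c)] is [c] with its apex and legs rebuilt from
    their two components. *)
Lemma total_fibre_cone_limit (c : Cone J) :
  is_limit c -> is_limit (total_cone (fibre_cone c)).
Proof.
destruct c as [[A X] m m_nat]; intros hc d.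
assert (hleg : forall e, leg (total_cone (fibre_cone
  {| apex := TotalObj X : total L; leg := m; cone_comm := m_nat |})) e = m e).
{ intros e; simpl; unfold total_cone_leg; simpl; now destruct (m e). }
destruct (hc d) as [u [hu uniq]]; exists u; split.
- intros e; rewrite hleg; apply hu.
- intros u' hu'; apply uniq; intros e; rewrite <- hu', hleg; reflexivity.
Qed.

End TotalCones.

Theorem theorem6p2 (C : Category) (L : IndexedCategory C) (E : Category)
  (J : Functor E (total L)) :
  (has_fibred_limit J <->
     exists l : Cone (J1 J),
       is_limit l /\
       exists k : Cone (induced_functor l),
         is_limit k /\
         forall (K : C) (u : Hom K (apex l)), preserved_by (reindex L u) k)
  /\
  (has_fibred_limit J ->
     forall (l : Cone (J1 J)) (k : Cone (induced_functor l)),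
       is_limit l -> is_limit k -> is_fibred_limit (total_cone k)).
Proof.
split; [split|].
- intros [c [hc hbase]].
  exists (map_cone (total_proj L) c); split; [exact hbase|].
  assert (hpres := proj1 (total_cone_limit_iff (fibre_cone c) hbase)
    (total_fibre_cone_limit hc)).
  exists (fibre_cone c); split; [|exact hpres].
  apply preserved_by_reindex_id, hpres.
- intros [l [hl [k [_ hpres]]]].
  exists (total_cone k); split; [|exact hl].
  now apply total_cone_limit_iff.
- intros [c hc] l k hl hk; split; [|exact hl].
  exact (limit_total_cone hc hl hk).
Qed.
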